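(* Let $(a,c)\in\mathbb{R}^2$ and let $(\Sigma,ds^2)$ be a smooth Riemannian surface with curvature $K$ such that $K-c$ does not vanish. (1) If $a\neq0$, then $(\Sigma,ds^2)$ is a generalized Ricci surface of type $(a,0,c)$ if and only if $|K-c|^{2/a}ds^2$ is a flat metric on $\Sigma$. (2) Let $b=(2-a)c$. Then $(\Sigma,ds^2)$ is a generalized Ricci surface of type $(a,b,c)$ if and only if $|K-c|ds^2$ is a metric with constant curvature $\left(1-\frac a2\right)\operatorname{sign}(K-c)$ on $\Sigma$.
   Context: Smooth means of class $C^\infty$; surfaces are connected and without boundary. For $(a,b,c)\in\mathbb{R}^3$, a smooth Riemannian surface $(\Sigma,ds^2)$ with Gaussian curvature $K$ is a generalized Ricci surface of type $(a,b,c)$ if $(c-K)\Delta K+\|\nabla K\|^2+(aK+b)(K-c)^2=0$ on $\Sigma$, where $\Delta=\operatorname{div}\nabla$. Since $K-c$ does not vanish and $\Sigma$ is connected, $\operatorname{sign}(K-c)\in\{-1,1\}$ is the constant sign of $K-c$. *)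

(* Defs.v *)
From Stdlib Require Import Reals.
From Coquelicot Require Import Coquelicot.
Open Scope R_scope.

(** * Calculus on open subsets of R^2 *)

Definition open_2d (U : R -> R -> Prop) : Prop :=
  forall x y, U x y -> locally_2d U x y.

(* [ex_diff_n f n x y] only constrains the iterated partial derivatives at the
   single point (x, y); required for all n at every point of an open set U, it
   says that all of them exist and are continuous on U. *)
Definition smooth_on (U : R -> R -> Prop) (f : R -> R -> R) : Prop :=
  forall n x y, U x y -> ex_diff_n f n x y.

Inductive axis : Set := X1 | X2.

Definition partial (a : axis) (f : R -> R -> R) : R -> R -> R :=
  match a with
  | X1 => fun x y => Derive (fun t => f t y) x
  | X2 => fun x y => Derive (fun t => f x t) y
  end.

Definition axis_sum (F : axis -> R) : R := F X1 + F X2.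

(** * Smooth surfaces *)

(* A smooth structure in terms of local parametrizations [par i], defined on
   the open sets [dom i] of R^2, with inverses [coord i]; the values of [par i]
   outside [dom i], and of [coord i] outside [range i] below, are irrelevant.
   The atlas is not required to be maximal. *)
Record atlas : Type := Atlas {
  point :> Type;
  chart : Type;
  dom : chart -> R -> R -> Prop;
  par : chart -> R -> R -> point;
  coord : chart -> point -> R * R;
  dom_open : forall i, open_2d (dom i);
  coordK : forall i x y, dom i x y -> coord i (par i x y) = (x, y);
  charts_cover : forall p, exists i x y, dom i x y /\ par i x y = p;
  overlap_open : forall i j, open_2d (fun x y => dom i x y /\
    exists u v, dom j u v /\ par j u v = par i x y);
  transition_smooth : forall i j,
    let overlap := fun x y => dom i x y /\
      exists u v, dom j u v /\ par j u v = par i x y in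
    smooth_on overlap (fun x y => fst (coord j (par i x y))) /\
    smooth_on overlap (fun x y => snd (coord j (par i x y)))
}.

Arguments chart : clear implicits.
Arguments dom {a} _ _ _.
Arguments par {a} _ _ _.
Arguments coord {a} _ _.

Definition range {M : atlas} (i : chart M) (p : M) : Prop :=
  exists x y, dom i x y /\ par i x y = p.

Definition transition {M : atlas} (i j : chart M) (k : axis) (x y : R) : R :=
  match k with
  | X1 => fst (coord j (par i x y))
  | X2 => snd (coord j (par i x y))
  end.

(* The topology induced by the atlas. *)
Definition open_set {M : atlas} (A : M -> Prop) : Prop :=
  forall i : chart M, open_2d (fun x y => dom i x y /\ A (par i x y)).

Definition hausdorff (M : atlas) : Prop :=
  forall p q : M, p <> q -> exists A B : M -> Prop,
    open_set A /\ open_set B /\ A p /\ B q /\ forall r, ~ (A r /\ B r).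

Definition second_countable (M : atlas) : Prop :=
  exists B : nat -> M -> Prop,
    (forall n, open_set (B n)) /\
    (forall (A : M -> Prop) p, open_set A -> A p ->
       exists n, B n p /\ forall q, B n q -> A q).

Definition connected (M : atlas) : Prop :=
  ~ exists A B : M -> Prop,
      open_set A /\ open_set B /\ (exists p, A p) /\ (exists q, B q) /\
      (forall p, A p \/ B p) /\ (forall p, ~ (A p /\ B p)).

Record surface : Type := Surface {
  surface_atlas :> atlas;
  surface_hausdorff : hausdorff surface_atlas;
  surface_second_countable : second_countable surface_atlas;
  surface_connected : connected surface_atlas
}.

(** * Riemannian geometry in one chart *)

(* g a b x y is the coefficient g_ab of the metric at (x, y). *)
Definition local_metric : Type := axis -> axis -> R -> R -> R.

Definition vector_field : Type := axis -> R -> R -> R.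

Definition metric_det (g : local_metric) (x y : R) : R :=
  g X1 X1 x y * g X2 X2 x y - g X1 X2 x y * g X2 X1 x y.

(* The inverse matrix g^ab. *)
Definition metric_inv (g : local_metric) (a b : axis) (x y : R) : R :=
  match a, b with
  | X1, X1 => g X2 X2 x y / metric_det g x y
  | X1, X2 => - g X1 X2 x y / metric_det g x y
  | X2, X1 => - g X2 X1 x y / metric_det g x y
  | X2, X2 => g X1 X1 x y / metric_det g x y
  end.

(* The symbol Gamma^k_ab. *)
Definition christoffel (g : local_metric) (k a b : axis) (x y : R) : R :=
  / 2 * axis_sum (fun l => metric_inv g k l x y *
    (partial a (g b l) x y + partial b (g a l) x y - partial l (g a b) x y)).

(* The component R^l_kab, with the convention
   R(d_a, d_b) d_k = D_a D_b d_k - D_b D_a d_k = sum_l R^l_kab d_l. *)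
Definition riemann (g : local_metric) (l k a b : axis) (x y : R) : R :=
  partial a (christoffel g l b k) x y - partial b (christoffel g l a k) x y
  + axis_sum (fun m =>
      christoffel g l a m x y * christoffel g m b k x y
      - christoffel g l b m x y * christoffel g m a k x y).

(* The sectional curvature <R(d_1, d_2) d_2, d_1> / (g_11 g_22 - g_12^2). *)
Definition local_gauss_curvature (g : local_metric) (x y : R) : R :=
  axis_sum (fun l => g X1 l x y * riemann g l X2 X1 X2 x y) / metric_det g x y.

Definition grad (g : local_metric) (f : R -> R -> R) : vector_field :=
  fun a x y => axis_sum (fun b => metric_inv g a b x y * partial b f x y).

Definition norm_sq (g : local_metric) (V : vector_field) (x y : R) : R :=
  axis_sum (fun a => axis_sum (fun b => g a b x y * V a x y * V b x y)).

Definition div (g : local_metric) (V : vector_field) (x y : R) : R :=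
  axis_sum (fun a =>
    partial a (fun u v => sqrt (metric_det g u v) * V a u v) x y)
  / sqrt (metric_det g x y).

Definition laplacian (g : local_metric) (f : R -> R -> R) : R -> R -> R :=
  div g (grad g f).

(** * Riemannian surfaces *)

(* The coefficients of a field of bilinear forms, in every chart. *)
Definition tensor (S : surface) : Type := chart S -> local_metric.

Record riemannian_metric {S : surface} (g : tensor S) : Prop := {
  metric_smooth : forall i a b, smooth_on (dom i) (g i a b);
  metric_sym : forall i a b x y, dom i x y -> g i a b x y = g i b a x y;
  metric_pos : forall i x y, dom i x y ->
    forall v : axis -> R, (exists a, v a <> 0) ->
      0 < axis_sum (fun a => axis_sum (fun b => g i a b x y * v a * v b));
  metric_change : forall i j a b x y, dom i x y -> range j (par i x y) ->
    g i a b x y =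
      axis_sum (fun k => axis_sum (fun l =>
        partial a (transition i j k) x y * partial b (transition i j l) x y
        * g j k l (transition i j X1 x y) (transition i j X2 x y)))
}.

(* K is the Gaussian curvature of g: its expression in every chart is the
   local one. As the charts cover S, there is at most one such K. *)
Definition is_gauss_curvature {S : surface} (g : tensor S) (K : S -> R) : Prop :=
  forall i x y, dom i x y -> K (par i x y) = local_gauss_curvature (g i) x y.

Definition generalized_ricci {S : surface} (a b c : R) (g : tensor S) : Prop :=
  riemannian_metric g /\
  exists K : S -> R, is_gauss_curvature g K /\
    forall i x y, dom i x y ->
      let k := fun u v => K (par i u v) in
      (c - k x y) * laplacian (g i) k x y
      + norm_sq (g i) (grad (g i) k) x y
      + (a * k x y + b) * (k x y - c) ^ 2 = 0.

Definition constant_curvature_metric {S : surface} (g : tensor S) (k : R) : Prop :=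
  riemannian_metric g /\ is_gauss_curvature g (fun _ => k).

Definition flat_metric {S : surface} (g : tensor S) : Prop :=
  constant_curvature_metric g 0.

(* The conformal tensor f ds^2. *)
Definition conformal {S : surface} (f : S -> R) (g : tensor S) : tensor S :=
  fun i a b x y => f (par i x y) * g i a b x y.

(* Main.v *)
Require Import Defs.
From Stdlib Require Import Reals Lra FunctionalExtensionality.
From Coquelicot Require Import Coquelicot.
Open Scope R_scope.

(** In a chart, write g for the metric, k for its curvature and Delta for its
    Laplacian. Two facts of calculus give the theorem.

    The first is the behaviour of the Gaussian curvature under a conformal
    change, K(e^phi g) = e^(-phi) (k - (1/2) Delta phi)
    ([local_gauss_curvature_rescaled]). The second is the chain rule
    Delta ln|k - c| = ((k - c) Delta k - |grad k|^2) / (k - c)^2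
    ([laplacian_log_factor]), whose right-hand side is made of the first two
    terms of the Ricci equation. Since |k - c|^beta = e^(beta ln|k - c|), they
    combine into the curvature of |k - c|^beta g ([power_metric_curvature]):
    it equals |k - c|^(-beta) times
    k - (beta/2) ((k - c) Delta k - |grad k|^2) / (k - c)^2.

    With beta = 2/a this is a nonzero multiple of the left-hand side of the
    Ricci equation of type (a, 0, c). With beta = 1, subtracting
    (1 - a/2) sign (k - c) leaves a nonzero multiple of the left-hand side of
    the equation of type (a, (2 - a) c, c), because
    |k - c| sign (k - c) = k - c. The sign may be read off at a single point:
    k is smooth, being a rational expression in the coefficients of the metric
    and their partial derivatives, hence continuous, and the surface is connected
    ([constant_sign]).

    The conformal law is proved by comparing Levi-Civita connections. The
    Christoffel symbols of e^phi g and g differ by a tensor which is first order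
    in phi ([christoffel_rescaled]), so the second derivatives of g cancel in the
    difference of the curvatures. What remains is a rational identity in the
    values and first derivatives of the components of g and of V = grad phi
    ([curvature_shift]). *)

(** * Partial derivatives and smooth functions *)

(** Unlike the total function [partial], this also says that the derivative
    exists; it is the form in which the rules of calculus compose. *)
Definition is_partial (a : axis) (f : R -> R -> R) (x y l : R) : Prop :=
  match a with
  | X1 => is_derive (fun t => f t y) x l
  | X2 => is_derive (fun t => f x t) y l
  end.

Lemma is_partial_unique a f x y l : is_partial a f x y l -> partial a f x y = l.
Proof. destruct a; apply is_derive_unique. Qed.

Lemma is_partial_const a (c : R) x y : is_partial a (fun _ _ => c) x y 0.
Proof. destruct a; exact (is_derive_const (K := R_AbsRing) (V := R_NormedModule) c _). Qed.

Lemma is_partial_plus a f h x y l m :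
  is_partial a f x y l -> is_partial a h x y m ->
  is_partial a (fun u v => f u v + h u v) x y (l + m).
Proof. destruct a; intros Hf Hh;
  exact (is_derive_plus (K := R_AbsRing) (V := R_NormedModule) _ _ _ _ _ Hf Hh). Qed.

Lemma is_partial_mult a f h x y l m :
  is_partial a f x y l -> is_partial a h x y m ->
  is_partial a (fun u v => f u v * h u v) x y (l * h x y + f x y * m).
Proof.
  destruct a; intros Hf Hh;
  exact (is_derive_mult (K := R_AbsRing) _ _ _ _ _ Hf Hh Rmult_comm).
Qed.

Lemma is_partial_comp (psi : R -> R) a f x y l m :
  is_derive psi (f x y) m -> is_partial a f x y l ->
  is_partial a (fun u v => psi (f u v)) x y (m * l).
Proof.
  destruct a; intros Hp Hf; simpl in *; rewrite Rmult_comm;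
  [ exact (is_derive_comp psi (fun t => f t y) x m l Hp Hf)
  | exact (is_derive_comp psi (fun t => f x t) y m l Hp Hf) ].
Qed.

Lemma is_derive_ln_Rabs t : t <> 0 -> is_derive (fun s => ln (Rabs s)) t (/ t).
Proof.
  intros Ht.
  assert (Ha : 0 < Rabs t) by (apply Rabs_pos_lt, Ht).
  replace (/ t) with (sign t * 1 * / Rabs t).
  - apply (is_derive_comp (K := R_AbsRing) (V := R_NormedModule) ln Rabs); [apply is_derive_ln, Ha|].
    apply (is_derive_Rabs (fun s => s)); [exact (is_derive_id (K := R_AbsRing) t)|exact Ht].
  - destruct (Rtotal_order t 0) as [H|[H|H]]; [|contradiction|].
    + rewrite (sign_eq_m1 t H), (Rabs_left t H); field; exact Ht.
    + rewrite (sign_eq_1 t H), (Rabs_right t (Rgt_ge _ _ H)); field; exact Ht.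
Qed.

Section OpenSet.

Variable U : R -> R -> Prop.
Hypothesis U_open : open_2d U.

Lemma locally_eq_on (f h : R -> R -> R) x y :
  (forall u v, U u v -> f u v = h u v) -> U x y ->
  locally_2d (fun u v => f u v = h u v) x y.
Proof.
  intros Hfh HU.
  destruct (U_open x y HU) as [d Hd].
  exists d; intros u v Hu Hv; apply Hfh, Hd; assumption.
Qed.

Lemma partial_ext a f h x y :
  (forall u v, U u v -> f u v = h u v) -> U x y ->
  partial a f x y = partial a h x y.
Proof.
  intros Hfh HU.
  pose proof (locally_eq_on f h x y Hfh HU) as L.
  destruct a; simpl; apply Derive_ext_loc.
  - exact (locally_2d_1d_const_y _ _ _ L).
  - exact (locally_2d_1d_const_x _ _ _ L).
Qed.

Lemma smooth_on_ext f h :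
  (forall u v, U u v -> f u v = h u v) -> smooth_on U f -> smooth_on U h.
Proof.
  intros Hfh Hf n x y HU.
  exact (ex_diff_n_ext_loc f h n x y (locally_eq_on f h x y Hfh HU) (Hf n x y HU)).
Qed.

Lemma smooth_on_continuous f x y :
  smooth_on U f -> U x y -> continuity_2d_pt f x y.
Proof. intros Hf HU; exact (proj1 (Hf 0%nat x y HU)). Qed.

Lemma smooth_on_is_partial f a x y :
  smooth_on U f -> U x y -> is_partial a f x y (partial a f x y).
Proof.
  intros Hf HU; destruct (Hf 1%nat x y HU) as [_ [H1 [H2 _]]].
  destruct a; apply Derive_correct; assumption.
Qed.

Lemma smooth_on_partial f a : smooth_on U f -> smooth_on U (partial a f).
Proof.
  intros Hf n x y HU; destruct (Hf (S n) x y HU) as [_ [_ [_ [H1 H2]]]].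
  destruct a; assumption.
Qed.

(** Exhibiting a class of functions stable under differentiation replaces the
    computation of iterated partial derivatives of every order. *)
Lemma smooth_on_coind (C : (R -> R -> R) -> Prop) :
  (forall f, C f ->
     (forall x y, U x y -> continuity_2d_pt f x y) /\
     forall a, exists h, C h /\ forall x y, U x y -> is_partial a f x y (h x y)) ->
  forall f, C f -> smooth_on U f.
Proof.
  intros HC f Cf n; revert f Cf.
  induction n as [|n IH]; intros f Cf x y HU;
    destruct (HC f Cf) as [Hc Hp]; split; auto.
  destruct (Hp X1) as [h1 [C1 P1]]; destruct (Hp X2) as [h2 [C2 P2]].
  split; [eexists; apply (P1 x y HU)|].
  split; [eexists; apply (P2 x y HU)|].
  split.
  - apply (ex_diff_n_ext_loc h1); [|apply IH; assumption].
    apply locally_eq_on; [|assumption].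
    intros u v HUuv; symmetry; exact (is_partial_unique X1 f u v _ (P1 u v HUuv)).
  - apply (ex_diff_n_ext_loc h2); [|apply IH; assumption].
    apply locally_eq_on; [|assumption].
    intros u v HUuv; symmetry; exact (is_partial_unique X2 f u v _ (P2 u v HUuv)).
Qed.

(** The class to which [smooth_on_coind] is applied: it is closed under partial
    derivatives by the rules of calculus, so that one induction yields all the
    closure properties of smooth functions at once. *)
Inductive generated : (R -> R -> R) -> Prop :=
| gen_smooth f : smooth_on U f -> generated f
| gen_const c : generated (fun _ _ => c)
| gen_plus f h : generated f -> generated h -> generated (fun u v => f u v + h u v)
| gen_mult f h : generated f -> generated h -> generated (fun u v => f u v * h u v)
| gen_inv f : (forall u v, U u v -> f u v <> 0) -> generated f ->
    generated (fun u v => / f u v)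
| gen_exp f : generated f -> generated (fun u v => exp (f u v)).

Lemma generated_smooth f : generated f -> smooth_on U f.
Proof.
  apply smooth_on_coind; clear f.
  induction 1 as [f Hf|c|f h Gf [Cf Pf] Gh [Ch Ph]|f h Gf [Cf Pf] Gh [Ch Ph]
                 |f f0 Gf [Cf Pf]|f Gf [Cf Pf]].
  - split; [intros; apply smooth_on_continuous; assumption|].
    intros a; exists (partial a f); split.
    + apply gen_smooth, smooth_on_partial, Hf.
    + intros; apply smooth_on_is_partial; assumption.
  - split; [intros; apply continuity_2d_pt_const|].
    intros a; exists (fun _ _ => 0); split; [apply gen_const|].
    intros; apply is_partial_const.
  - split; [intros; apply continuity_2d_pt_plus; auto|].
    intros a; destruct (Pf a) as [f' [Gf' Pf']]; destruct (Ph a) as [h' [Gh' Ph']].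
    exists (fun u v => f' u v + h' u v); split; [apply gen_plus; assumption|].
    intros; apply is_partial_plus; auto.
  - split; [intros; apply continuity_2d_pt_mult; auto|].
    intros a; destruct (Pf a) as [f' [Gf' Pf']]; destruct (Ph a) as [h' [Gh' Ph']].
    exists (fun u v => f' u v * h u v + f u v * h' u v); split.
    + apply gen_plus; apply gen_mult; assumption.
    + intros; apply is_partial_mult; auto.
  - split; [intros; apply continuity_2d_pt_inv; auto|].
    intros a; destruct (Pf a) as [f' [Gf' Pf']].
    (* - f' / f^2, written with the constructors of [generated] only *)
    exists (fun u v => (-1 * (/ f u v * / f u v)) * f' u v); split.
    + repeat apply gen_mult; try apply gen_const; try apply gen_inv; assumption.
    + intros x y HU; apply (is_partial_comp Rinv); [|auto].
      auto_derive; [auto|field; auto].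
  - split.
    + intros; apply (continuity_1d_2d_pt_comp exp); [|auto].
      apply derivable_continuous, derivable_exp.
    + intros a; destruct (Pf a) as [f' [Gf' Pf']].
      exists (fun u v => exp (f u v) * f' u v); split.
      * apply gen_mult; [apply gen_exp|]; assumption.
      * intros x y HU; apply (is_partial_comp exp); [apply is_derive_exp|auto].
Qed.

Lemma smooth_on_const c : smooth_on U (fun _ _ => c).
Proof. apply generated_smooth, gen_const. Qed.

Lemma smooth_on_plus f h :
  smooth_on U f -> smooth_on U h -> smooth_on U (fun u v => f u v + h u v).
Proof. intros; apply generated_smooth, gen_plus; apply gen_smooth; assumption. Qed.

Lemma smooth_on_mult f h :
  smooth_on U f -> smooth_on U h -> smooth_on U (fun u v => f u v * h u v).
Proof. intros; apply generated_smooth, gen_mult; apply gen_smooth; assumption. Qed.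

Lemma smooth_on_opp f : smooth_on U f -> smooth_on U (fun u v => - f u v).
Proof.
  intros Hf; apply (smooth_on_ext (fun u v => -1 * f u v)); [intros; ring|].
  apply smooth_on_mult; [apply smooth_on_const|exact Hf].
Qed.

Lemma smooth_on_minus f h :
  smooth_on U f -> smooth_on U h -> smooth_on U (fun u v => f u v - h u v).
Proof. intros; apply smooth_on_plus; [|apply smooth_on_opp]; assumption. Qed.

Lemma smooth_on_inv f :
  (forall u v, U u v -> f u v <> 0) -> smooth_on U f ->
  smooth_on U (fun u v => / f u v).
Proof. intros; apply generated_smooth, gen_inv; [|apply gen_smooth]; assumption. Qed.

Lemma smooth_on_div f h :
  (forall u v, U u v -> h u v <> 0) -> smooth_on U f -> smooth_on U h ->
  smooth_on U (fun u v => f u v / h u v).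
Proof. intros; apply smooth_on_mult; [|apply smooth_on_inv]; assumption. Qed.

Lemma smooth_on_exp f : smooth_on U f -> smooth_on U (fun u v => exp (f u v)).
Proof. intros; apply generated_smooth, gen_exp, gen_smooth; assumption. Qed.

Lemma partial_ln_Rabs f a x y :
  f x y <> 0 -> smooth_on U f -> U x y ->
  is_partial a (fun u v => ln (Rabs (f u v))) x y (/ f x y * partial a f x y).
Proof.
  intros f0 Hf HU; apply (is_partial_comp (fun s => ln (Rabs s))).
  - apply is_derive_ln_Rabs, f0.
  - apply smooth_on_is_partial; assumption.
Qed.

(** The logarithm can be left out of [generated]: after one derivative it has
    disappeared, so that smooth functions together with this single one form a
    class stable under partial derivatives. *)
Lemma smooth_on_ln_Rabs f :
  (forall u v, U u v -> f u v <> 0) -> smooth_on U f ->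
  smooth_on U (fun u v => ln (Rabs (f u v))).
Proof.
  intros f0 Hf.
  apply (smooth_on_coind
    (fun h => h = (fun u v => ln (Rabs (f u v))) \/ smooth_on U h)); [|left; reflexivity].
  intros h [->|Hh].
  - split.
    + intros x y HU; apply (continuity_1d_2d_pt_comp (fun s => ln (Rabs s))).
      * apply continuity_pt_filterlim, (ex_derive_continuous (fun s => ln (Rabs s))).
        eexists; apply is_derive_ln_Rabs, f0, HU.
      * apply smooth_on_continuous; assumption.
    + intros a; exists (fun u v => / f u v * partial a f u v); split.
      * right; apply smooth_on_mult; try assumption.
        -- apply smooth_on_inv; assumption.
        -- apply smooth_on_partial, Hf.
      * intros; apply partial_ln_Rabs; auto.
  - split; [intros; apply smooth_on_continuous; assumption|].
    intros a; exists (partial a h); split.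
    + right; apply smooth_on_partial, Hh.
    + intros; apply smooth_on_is_partial; assumption.
Qed.

Lemma partial_comm f x y :
  smooth_on U f -> U x y ->
  partial X1 (partial X2 f) x y = partial X2 (partial X1 f) x y.
Proof.
  intros Hf HU.
  pose proof (smooth_on_partial f X1 Hf) as H1.
  pose proof (smooth_on_partial f X2 Hf) as H2.
  apply Schwarz.
  - destruct (U_open x y HU) as [d Hd]; exists d; intros u v Hu Hv.
    pose proof (Hd u v Hu Hv) as HUuv.
    repeat split; eexists.
    + apply (smooth_on_is_partial f X1); assumption.
    + apply (smooth_on_is_partial f X2); assumption.
    + apply (smooth_on_is_partial (partial X2 f) X1); assumption.
    + apply (smooth_on_is_partial (partial X1 f) X2); assumption.
  - apply (smooth_on_continuous (partial X1 (partial X2 f))); [|assumption].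
    apply smooth_on_partial, H2.
  - apply (smooth_on_continuous (partial X2 (partial X1 f))); [|assumption].
    apply smooth_on_partial, H1.
Qed.

End OpenSet.

(** * Conformal changes of a metric in one chart *)

Section ConformalChange.

Variables (U : R -> R -> Prop) (g : local_metric).
Hypothesis U_open : open_2d U.
Hypothesis g_smooth : forall a b, smooth_on U (g a b).
Hypothesis g_sym : forall x y, U x y -> g X2 X1 x y = g X1 X2 x y.
Hypothesis det_pos : forall x y, U x y -> 0 < metric_det g x y.

Lemma det_neq0 x y : U x y -> metric_det g x y <> 0.
Proof. intros HU; apply Rgt_not_eq, det_pos, HU. Qed.

Lemma partial_metric_sym a x y : U x y -> partial a (g X2 X1) x y = partial a (g X1 X2) x y.
Proof. apply (partial_ext U U_open), g_sym. Qed.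

Lemma smooth_on_det : smooth_on U (metric_det g).
Proof. apply smooth_on_minus; try apply smooth_on_mult; auto. Qed.

Lemma smooth_on_metric_inv a b : smooth_on U (metric_inv g a b).
Proof.
  pose proof smooth_on_det as Hdet.
  destruct a, b; apply (smooth_on_div U U_open); auto using det_neq0;
    apply (smooth_on_opp U U_open); auto.
Qed.

Lemma smooth_on_christoffel k a b : smooth_on U (christoffel g k a b).
Proof.
  assert (H : forall l, smooth_on U (fun x y => metric_inv g k l x y *
      (partial a (g b l) x y + partial b (g a l) x y - partial l (g a b) x y))).
  { intros l; apply smooth_on_mult; [exact U_open|apply smooth_on_metric_inv|].
    apply smooth_on_minus; [exact U_open| |apply smooth_on_partial; auto].
    apply smooth_on_plus; [exact U_open| |]; apply smooth_on_partial; auto. }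
  apply (smooth_on_mult U U_open (fun _ _ => / 2)); [apply smooth_on_const, U_open|].
  apply smooth_on_plus; auto.
Qed.

Lemma smooth_on_riemann l k a b : smooth_on U (riemann g l k a b).
Proof.
  assert (H : forall m, smooth_on U (fun x y =>
      christoffel g l a m x y * christoffel g m b k x y
      - christoffel g l b m x y * christoffel g m a k x y)).
  { intros m; apply smooth_on_minus; [exact U_open| |];
      apply smooth_on_mult; auto using smooth_on_christoffel. }
  apply smooth_on_plus; [exact U_open| |].
  - apply smooth_on_minus; [exact U_open| |];
      apply smooth_on_partial, smooth_on_christoffel.
  - apply smooth_on_plus; auto.
Qed.

Lemma smooth_on_local_gauss_curvature : smooth_on U (local_gauss_curvature g).
Proof.
  apply (smooth_on_div U U_open);
    [exact det_neq0 | | exact smooth_on_det].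
  apply smooth_on_plus; [exact U_open| |]; apply smooth_on_mult;
    auto using smooth_on_riemann.
Qed.

Variable phi : R -> R -> R.
Hypothesis phi_smooth : smooth_on U phi.

Lemma smooth_on_grad a : smooth_on U (grad g phi a).
Proof.
  apply smooth_on_plus; [exact U_open| |];
    (apply smooth_on_mult; [exact U_open|apply smooth_on_metric_inv|]);
    apply smooth_on_partial, phi_smooth.
Qed.

(** Lowering the index of the gradient. It lets the components of
    V = grad phi and their derivatives replace those of phi in the curvature
    computation, so that no inverse metric has to be differentiated. *)
Lemma lower_grad b x y : U x y ->
  partial b phi x y = axis_sum (fun l => g b l x y * grad g phi l x y).
Proof.
  intros HU; pose proof (det_neq0 x y HU) as Hd; revert Hd.
  destruct b; unfold grad, axis_sum, metric_inv, metric_det;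
    rewrite (g_sym x y HU); intros Hd; field; exact Hd.
Qed.

Lemma partial_lower_grad a b x y : U x y ->
  partial a (partial b phi) x y =
  axis_sum (fun l => partial a (g b l) x y * grad g phi l x y
                     + g b l x y * partial a (grad g phi l) x y).
Proof.
  intros HU.
  rewrite (partial_ext U U_open a (partial b phi)
    (fun u v => axis_sum (fun l => g b l u v * grad g phi l u v)));
    [| intros; apply lower_grad; assumption | assumption].
  apply is_partial_unique, is_partial_plus; apply is_partial_mult;
    apply (smooth_on_is_partial U); auto using smooth_on_grad.
Qed.

(** The square roots of the definition disappear because
    d (sqrt det) / sqrt det = d det / (2 det). *)
Lemma div_expand V x y : (forall a, smooth_on U (V a)) -> U x y ->
  div g V x y = axis_sum (fun a => partial a (V a) x y
    + V a x y * (partial a (metric_det g) x y / (2 * metric_det g x y))).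
Proof.
  intros HV HU.
  pose proof (det_pos x y HU) as Hd; pose proof (sqrt_lt_R0 _ Hd) as Hs.
  assert (H : forall a,
    partial a (fun u v => sqrt (metric_det g u v) * V a u v) x y
    = / (2 * sqrt (metric_det g x y)) * partial a (metric_det g) x y * V a x y
      + sqrt (metric_det g x y) * partial a (V a) x y).
  { intros a; apply is_partial_unique, is_partial_mult.
    - apply (is_partial_comp sqrt).
      + auto_derive; [exact Hd|]. field. lra.
      + apply (smooth_on_is_partial U); auto using smooth_on_det.
    - apply (smooth_on_is_partial U); auto. }
  unfold div, axis_sum; rewrite !H.
  pose proof (sqrt_sqrt (metric_det g x y) (Rlt_le _ _ Hd)) as Hss.
  revert Hs Hss; generalize (sqrt (metric_det g x y)); intros s Hs <-.
  field; lra.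
Qed.

Lemma partial_det a x y : U x y ->
  partial a (metric_det g) x y =
  partial a (g X1 X1) x y * g X2 X2 x y + g X1 X1 x y * partial a (g X2 X2) x y
  - 2 * g X1 X2 x y * partial a (g X1 X2) x y.
Proof.
  intros HU.
  rewrite (partial_ext U U_open a (metric_det g)
    (fun u v => g X1 X1 u v * g X2 X2 u v + (-1 * g X1 X2 u v) * g X1 X2 u v));
    [| intros u v HUuv; unfold metric_det; rewrite (g_sym u v HUuv); ring | assumption].
  erewrite is_partial_unique;
    [| apply is_partial_plus; apply is_partial_mult;
       [| | apply is_partial_mult; [apply is_partial_const|]|];
       apply (smooth_on_is_partial U); auto].
  cbv beta; ring.
Qed.

Definition kronecker (i j : axis) : R :=
  match i, j with X1, X1 | X2, X2 => 1 | _, _ => 0 end.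

(** The difference of the Levi-Civita connections of e^phi g and g. *)
Definition connection_shift (k a b : axis) (x y : R) : R :=
  / 2 * (kronecker k a * partial b phi x y + kronecker k b * partial a phi x y
         - (g a b x y * grad g phi k x y)).

Definition rescaled : local_metric := fun a b x y => exp (phi x y) * g a b x y.

Lemma det_rescaled x y : metric_det rescaled x y = exp (phi x y) ^ 2 * metric_det g x y.
Proof. unfold metric_det, rescaled; ring. Qed.

Lemma partial_rescaled c a b x y : U x y ->
  partial c (rescaled a b) x y =
  exp (phi x y) * (partial c phi x y * g a b x y + partial c (g a b) x y).
Proof.
  intros HU.
  erewrite is_partial_unique;
    [| apply is_partial_mult; [apply (is_partial_comp exp); [apply is_derive_exp|]|];
       apply (smooth_on_is_partial U); auto].
  cbv beta; ring.
Qed.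

(** The terms in which e^phi is not differentiated reproduce the symbols of g,
    since the inverse metric carries e^(-phi); the three others make up the
    shift. *)
Lemma christoffel_rescaled k a b x y : U x y ->
  christoffel rescaled k a b x y = christoffel g k a b x y + connection_shift k a b x y.
Proof.
  intros HU; pose proof (det_neq0 x y HU) as Hd.
  pose proof (Rgt_not_eq _ _ (exp_pos (phi x y))) as He.
  unfold christoffel, connection_shift, kronecker, grad, axis_sum.
  rewrite !partial_rescaled by exact HU.
  assert (Hinv : forall i j, metric_inv rescaled i j x y
    = metric_inv g i j x y / exp (phi x y)).
  { intros i j; destruct i, j; unfold metric_inv; rewrite det_rescaled;
      unfold rescaled; field; auto. }
  rewrite !Hinv; clear Hinv.
  assert (Hs : forall c, partial c (g X2 X1) x y = partial c (g X1 X2) x y)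
    by (intros c; apply partial_metric_sym, HU).
  revert Hd; unfold metric_inv, metric_det; rewrite (g_sym x y HU).
  intros Hd.
  destruct k, a, b; rewrite ?Hs, ?(g_sym x y HU); field; auto.
Qed.

Lemma partial_connection_shift c k a b x y : U x y ->
  is_partial c (connection_shift k a b) x y
    (/ 2 * (kronecker k a * partial c (partial b phi) x y
            + kronecker k b * partial c (partial a phi) x y
            - (partial c (g a b) x y * grad g phi k x y
               + g a b x y * partial c (grad g phi k) x y))).
Proof.
  intros HU.
  assert (S : forall h l m, is_partial c h x y m -> l = m -> is_partial c h x y l)
    by (intros; subst; assumption).
  eapply S.
  - unfold connection_shift.
    apply (is_partial_mult c (fun _ _ => / 2)); [apply is_partial_const|].
    apply is_partial_plus; [apply is_partial_plus|].
    + apply (is_partial_mult c (fun _ _ => _)); [apply is_partial_const|].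
      apply (smooth_on_is_partial U (partial b phi)); auto using smooth_on_partial.
    + apply (is_partial_mult c (fun _ _ => _)); [apply is_partial_const|].
      apply (smooth_on_is_partial U (partial a phi)); auto using smooth_on_partial.
    + apply (is_partial_comp Ropp); [auto_derive; [exact I|reflexivity]|].
      apply is_partial_mult; apply (smooth_on_is_partial U); auto using smooth_on_grad.
  - cbv beta; field.
Qed.

(** Curvature is the derivative of the connection plus a quadratic term in it:
    the part free of the shift is the curvature of g, so the second derivatives
    of g do not occur in the rest. *)
Lemma riemann_rescaled l k a b x y : U x y ->
  riemann rescaled l k a b x y =
  riemann g l k a b x y
  + (partial a (connection_shift l b k) x y - partial b (connection_shift l a k) x y
     + axis_sum (fun m =>
         christoffel g l a m x y * connection_shift m b k x y
         + connection_shift l a m x y * christoffel g m b k x y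
         + connection_shift l a m x y * connection_shift m b k x y
         - christoffel g l b m x y * connection_shift m a k x y
         - connection_shift l b m x y * christoffel g m a k x y
         - connection_shift l b m x y * connection_shift m a k x y)).
Proof.
  intros HU.
  assert (H : forall c i j m, partial c (christoffel rescaled i j m) x y
    = partial c (christoffel g i j m) x y + partial c (connection_shift i j m) x y).
  { intros c i j m.
    rewrite (partial_ext U U_open c _
      (fun u v => christoffel g i j m u v + connection_shift i j m u v));
      [| intros; apply christoffel_rescaled; assumption | exact HU].
    apply is_partial_unique, is_partial_plus.
    - apply (smooth_on_is_partial U); auto using smooth_on_christoffel.
    - pose proof (partial_connection_shift c i j m x y HU) as P.
      rewrite (is_partial_unique _ _ _ _ _ P); exact P. }
  unfold riemann, axis_sum; rewrite !H, !christoffel_rescaled by exact HU; ring.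
Qed.

(** Lowered to the first index, the curvature created by the shift has a
    single component on a surface, and its quadratic terms in V cancel: only the
    divergence of V survives. The mixed second derivatives of phi have two
    expressions through V, of which one has to be chosen throughout before the
    identity becomes one of rational functions. *)
Lemma curvature_shift x y : U x y ->
  axis_sum (fun l => g X1 l x y *
    (partial X1 (connection_shift l X2 X2) x y - partial X2 (connection_shift l X1 X2) x y
     + axis_sum (fun m =>
         christoffel g l X1 m x y * connection_shift m X2 X2 x y
         + connection_shift l X1 m x y * christoffel g m X2 X2 x y
         + connection_shift l X1 m x y * connection_shift m X2 X2 x y
         - christoffel g l X2 m x y * connection_shift m X1 X2 x y
         - connection_shift l X2 m x y * christoffel g m X1 X2 x y
         - connection_shift l X2 m x y * connection_shift m X1 X2 x y)))
  = - / 2 * metric_det g x y * laplacian g phi x y.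
Proof.
  intros HU; pose proof (det_neq0 x y HU) as Hd.
  unfold laplacian; rewrite (div_expand _ x y smooth_on_grad HU).
  unfold axis_sum.
  rewrite !(is_partial_unique _ _ _ _ _ (partial_connection_shift _ _ _ _ x y HU)).
  (* Everything is expressed through the derivative along X1 of the second
     component of d phi. *)
  rewrite <- (partial_comm U U_open phi x y phi_smooth HU).
  rewrite !(partial_det _ x y HU).
  rewrite !(partial_lower_grad _ _ x y HU).
  unfold connection_shift, kronecker, christoffel, axis_sum.
  rewrite !(lower_grad _ x y HU).
  revert Hd; unfold metric_inv, metric_det, axis_sum.
  rewrite ?(g_sym x y HU), ?(partial_metric_sym _ x y HU).
  intros Hd; field; exact Hd.
Qed.

(** The conformal law: one factor e^phi comes from lowering an index, two from
    the determinant, which leaves e^(-phi) in front. *)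
Theorem local_gauss_curvature_rescaled x y : U x y ->
  local_gauss_curvature rescaled x y =
  (local_gauss_curvature g x y - / 2 * laplacian g phi x y) / exp (phi x y).
Proof.
  intros HU; pose proof (det_neq0 x y HU) as Hd.
  pose proof (Rgt_not_eq _ _ (exp_pos (phi x y))) as He.
  pose proof (curvature_shift x y HU) as Hs.
  unfold local_gauss_curvature; rewrite det_rescaled.
  unfold axis_sum at 1; rewrite !(riemann_rescaled _ _ _ _ x y HU).
  unfold axis_sum at 1 in Hs; unfold rescaled at 1 2.
  unfold axis_sum at 3.
  match type of Hs with g X1 X1 x y * ?d1 + g X1 X2 x y * ?d2 = _ =>
    replace (exp (phi x y) * g X1 X1 x y * (riemann g X1 X2 X1 X2 x y + d1)
             + exp (phi x y) * g X1 X2 x y * (riemann g X2 X2 X1 X2 x y + d2))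
    with (exp (phi x y) * (g X1 X1 x y * riemann g X1 X2 X1 X2 x y
             + g X1 X2 x y * riemann g X2 X2 X1 X2 x y
             + (g X1 X1 x y * d1 + g X1 X2 x y * d2))) by ring
  end.
  rewrite Hs; field; auto.
Qed.

End ConformalChange.

(** * The conformal factor |k - c|^beta *)

Section LogarithmicFactor.

Variables (U : R -> R -> Prop) (g : local_metric).
Hypothesis U_open : open_2d U.
Hypothesis g_smooth : forall a b, smooth_on U (g a b).
Hypothesis g_sym : forall x y, U x y -> g X2 X1 x y = g X1 X2 x y.
Hypothesis det_pos : forall x y, U x y -> 0 < metric_det g x y.

Variables (k : R -> R -> R) (c beta : R).
Hypothesis k_smooth : smooth_on U k.
Hypothesis k_neq : forall x y, U x y -> k x y - c <> 0.

Definition log_factor (x y : R) : R := beta * ln (Rabs (k x y - c)).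

Lemma smooth_on_shifted : smooth_on U (fun u v => k u v - c).
Proof. apply smooth_on_minus; [exact U_open|exact k_smooth|apply smooth_on_const, U_open]. Qed.

Lemma smooth_on_log_factor : smooth_on U log_factor.
Proof.
  apply (smooth_on_mult U U_open (fun _ _ => beta)); [apply smooth_on_const, U_open|].
  apply (smooth_on_ln_Rabs U U_open (fun u v => k u v - c));
    [exact k_neq|exact smooth_on_shifted].
Qed.

Lemma is_partial_shifted a x y : U x y ->
  is_partial a (fun u v => k u v - c) x y (partial a k x y).
Proof.
  intros HU; rewrite <- (Rplus_0_r (partial a k x y)).
  apply is_partial_plus; [apply (smooth_on_is_partial U); auto|].
  apply is_partial_const.
Qed.

Lemma grad_log_factor a x y : U x y ->
  grad g log_factor a x y = beta * / (k x y - c) * grad g k a x y.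
Proof.
  intros HU.
  assert (H : forall b, partial b log_factor x y
    = beta * / (k x y - c) * partial b k x y).
  { intros b; erewrite is_partial_unique;
      [| apply (is_partial_mult b (fun _ _ => beta));
         [apply is_partial_const
         | apply (is_partial_comp (fun s => ln (Rabs s)) b (fun u v => k u v - c));
           [apply is_derive_ln_Rabs, k_neq, HU | apply is_partial_shifted, HU]]].
    ring. }
  unfold grad, axis_sum; rewrite !H; ring.
Qed.

(** Chain rule: the derivative of 1 / (k - c) produces the term in
    |grad k|^2, and the derivative of grad k the one in Delta k. *)
Lemma laplacian_log_factor x y : U x y ->
  laplacian g log_factor x y =
  beta * ((k x y - c) * laplacian g k x y - norm_sq g (grad g k) x y)
  / (k x y - c) ^ 2.
Proof.
  intros HU; pose proof (k_neq x y HU) as Hk; pose proof (det_pos x y HU) as Hd.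
  assert (Hn : norm_sq g (grad g k) x y
    = axis_sum (fun a => grad g k a x y * partial a k x y)).
  { unfold norm_sq, axis_sum.
    rewrite !(lower_grad U g g_sym det_pos k _ x y HU); unfold axis_sum; ring. }
  assert (Hp : forall a, partial a (grad g log_factor a) x y
    = beta * (- partial a k x y / (k x y - c) ^ 2 * grad g k a x y
              + / (k x y - c) * partial a (grad g k a) x y)).
  { intros a.
    rewrite (partial_ext U U_open a _
      (fun u v => (beta * / (k u v - c)) * grad g k a u v));
      [| intros; apply grad_log_factor; assumption | exact HU].
    erewrite is_partial_unique;
      [| apply is_partial_mult;
         [ apply (is_partial_mult a (fun _ _ => beta) (fun u v => / (k u v - c)));
           [ apply is_partial_const
           | apply (is_partial_comp Rinv a (fun u v => k u v - c));
             [apply (is_derive_inv (fun s => s)); [apply is_derive_Reals, derivable_pt_lim_id|exact Hk]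
             | apply is_partial_shifted, HU]]
         | apply (smooth_on_is_partial U); auto using smooth_on_grad ]].
    cbv beta; field; exact Hk. }
  unfold laplacian.
  assert (Hdiv : forall f, smooth_on U f -> div g (grad g f) x y
    = axis_sum (fun a => partial a (grad g f a) x y + grad g f a x y
        * (partial a (metric_det g) x y / (2 * metric_det g x y)))).
  { intros f Hf; apply (div_expand U g U_open); auto using smooth_on_grad. }
  rewrite (Hdiv k k_smooth), (Hdiv log_factor smooth_on_log_factor).
  rewrite Hn; unfold axis_sum; rewrite !Hp, !grad_log_factor by exact HU.
  field; lra.
Qed.

Lemma curvature_rescaled_log_factor x y : U x y ->
  local_gauss_curvature (rescaled g log_factor) x y =
  (local_gauss_curvature g x y
   - beta / 2 * ((k x y - c) * laplacian g k x y - norm_sq g (grad g k) x y)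
     / (k x y - c) ^ 2) / exp (log_factor x y).
Proof.
  intros HU.
  rewrite (local_gauss_curvature_rescaled U); auto using smooth_on_log_factor.
  rewrite laplacian_log_factor by exact HU; unfold Rdiv; ring.
Qed.

End LogarithmicFactor.

(** * Conformal metrics on a surface *)

Lemma metric_det_pos {S : surface} (g : tensor S) i x y :
  riemannian_metric g -> dom i x y -> 0 < metric_det (g i) x y.
Proof.
  intros Hg Hi; pose proof (metric_pos g Hg i x y Hi) as Hpos.
  pose proof (metric_sym g Hg i X2 X1 x y Hi) as Hs.
  assert (HE : 0 < g i X1 X1 x y).
  { specialize (Hpos (fun a => match a with X1 => 1 | X2 => 0 end)).
    unfold axis_sum in Hpos.
    assert (H : exists a, match a with X1 => 1 | X2 => 0 end <> 0) by (exists X1; lra).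
    specialize (Hpos H); lra. }
  (* On (-g_12, g_11) the metric takes the value g_11 * det. *)
  specialize (Hpos (fun a => match a with X1 => - g i X1 X2 x y | X2 => g i X1 X1 x y end)).
  unfold axis_sum in Hpos; unfold metric_det; rewrite Hs in *.
  assert (H : exists a, match a with X1 => - g i X1 X2 x y | X2 => g i X1 X1 x y end <> 0)
    by (exists X2; lra).
  specialize (Hpos H).
  apply (Rmult_lt_reg_l (g i X1 X1 x y)); [exact HE|].
  rewrite Rmult_0_r; eapply Rlt_le_trans; [exact Hpos|apply Req_le; ring].
Qed.

Lemma conformal_riemannian {S : surface} (f : S -> R) (g : tensor S) :
  riemannian_metric g -> (forall p, 0 < f p) ->
  (forall i, smooth_on (dom i) (fun u v => f (par i u v))) ->
  riemannian_metric (conformal f g).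
Proof.
  intros Hg f0 Hf; split.
  - intros i a b; apply (smooth_on_mult (dom i) (dom_open _ i)); [apply Hf|].
    apply metric_smooth, Hg.
  - intros i a b x y Hi; unfold conformal; f_equal; apply metric_sym; assumption.
  - intros i x y Hi v Hv.
    replace (axis_sum _) with (f (par i x y) *
      axis_sum (fun a => axis_sum (fun b => g i a b x y * v a * v b)))
      by (unfold conformal, axis_sum; ring).
    apply Rmult_lt_0_compat; [apply f0|apply (metric_pos g Hg); assumption].
  - intros i j a b x y Hi Hj; unfold conformal at 1.
    rewrite (metric_change g Hg i j a b x y Hi Hj).
    assert (Hp : par j (transition i j X1 x y) (transition i j X2 x y) = par i x y).
    { destruct Hj as [u [v [Hj Huv]]]; unfold transition.
      rewrite <- Huv, coordK by exact Hj; reflexivity. }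
    unfold conformal, axis_sum; rewrite Hp; ring.
Qed.

Lemma open_positive {S : surface} (h : S -> R) :
  (forall i x y, dom i x y -> continuity_2d_pt (fun u v => h (par i u v)) x y) ->
  Defs.open_set (fun p : S => 0 < h p).
Proof.
  intros Hc i x y [Hi Hp].
  apply locally_2d_and; [apply dom_open, Hi|].
  destruct (Hc i x y Hi (mkposreal _ Hp)) as [d Hd]; exists d.
  intros u v Hu Hv; specialize (Hd u v Hu Hv); simpl in Hd.
  apply Rabs_def2 in Hd; lra.
Qed.

(** The sets where h is positive and where it is negative are open and cover
    the surface. *)
Lemma constant_sign {S : surface} (h : S -> R) (p q : S) :
  (forall i x y, dom i x y -> continuity_2d_pt (fun u v => h (par i u v)) x y) ->
  (forall r, h r <> 0) -> sign (h p) = sign (h q).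
Proof.
  intros Hc h0.
  assert (H : forall p q : S, 0 < h p -> h q < 0 -> False).
  { clear p q; intros p q Hp Hq; apply (surface_connected S).
    exists (fun r : S => 0 < h r), (fun r : S => 0 < - h r); repeat split.
    - apply open_positive, Hc.
    - apply open_positive; intros; apply continuity_2d_pt_opp, Hc; assumption.
    - exists p; exact Hp.
    - exists q; lra.
    - intros r; pose proof (h0 r); destruct (Rtotal_order (h r) 0) as [|[|]]; lra.
    - intros r; lra. }
  destruct (Rtotal_order (h p) 0) as [Hp|[Hp|Hp]];
    destruct (Rtotal_order (h q) 0) as [Hq|[Hq|Hq]];
    try (now destruct (h0 _ Hp)); try (now destruct (h0 _ Hq));
    try (exfalso; eapply H; eassumption).
  - rewrite !sign_eq_m1 by assumption; reflexivity.
  - rewrite !sign_eq_1 by assumption; reflexivity.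
Qed.

Lemma gauss_curvature_unique {S : surface} (g : tensor S) (K K' : S -> R) :
  is_gauss_curvature g K -> is_gauss_curvature g K' -> K = K'.
Proof.
  intros HK HK'; apply functional_extensionality; intros p.
  destruct (charts_cover S p) as [i [x [y [Hi <-]]]].
  rewrite (HK i x y Hi), (HK' i x y Hi); reflexivity.
Qed.

(** * The Ricci equation and the curvature of |K - c|^beta ds^2 *)

Section PowerConformal.

Variables (S : surface) (g : tensor S) (K : S -> R) (c : R).
Hypothesis g_metric : riemannian_metric g.
Hypothesis K_curvature : is_gauss_curvature g K.
Hypothesis K_neq : forall p, K p - c <> 0.

Definition ricci_equation (a b : R) : Prop :=
  forall i x y, dom i x y ->
    let k := fun u v => K (par i u v) in
    (c - k x y) * laplacian (g i) k x y
    + norm_sq (g i) (grad (g i) k) x y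
    + (a * k x y + b) * (k x y - c) ^ 2 = 0.

Lemma generalized_ricciE a b : generalized_ricci a b c g <-> ricci_equation a b.
Proof.
  split.
  - intros [_ [K' [HK' H]]].
    rewrite <- (gauss_curvature_unique g K K' K_curvature HK') in H; exact H.
  - intros H; split; [exact g_metric|exists K; split; assumption].
Qed.

Lemma gauss_curvature_smooth i : smooth_on (dom i) (fun u v => K (par i u v)).
Proof.
  apply (smooth_on_ext (dom i) (dom_open _ i) (local_gauss_curvature (g i))).
  - intros u v Hi; symmetry; apply K_curvature, Hi.
  - apply smooth_on_local_gauss_curvature.
    + apply dom_open.
    + intros; apply metric_smooth, g_metric.
    + intros; apply metric_det_pos; assumption.
Qed.

Definition power_metric (beta : R) : tensor S :=
  conformal (fun p => Rpower (Rabs (K p - c)) beta) g.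

Lemma power_metric_riemannian beta : riemannian_metric (power_metric beta).
Proof.
  apply conformal_riemannian; [exact g_metric|intros; apply exp_pos|].
  intros i; apply (smooth_on_exp (dom i) (dom_open _ i)).
  apply (smooth_on_log_factor (dom i) (dom_open _ i) (fun u v => K (par i u v))).
  - apply gauss_curvature_smooth.
  - intros; apply K_neq.
Qed.

Lemma power_metric_curvature beta i x y : dom i x y ->
  let k := fun u v => K (par i u v) in
  local_gauss_curvature (power_metric beta i) x y =
  (k x y - beta / 2 * ((k x y - c) * laplacian (g i) k x y
                       - norm_sq (g i) (grad (g i) k) x y) / (k x y - c) ^ 2)
  / Rpower (Rabs (k x y - c)) beta.
Proof.
  intros Hi k.
  unfold k at 1; rewrite (K_curvature i x y Hi).
  apply (curvature_rescaled_log_factor (dom i) (g i) (dom_open _ i)); try assumption.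
  - intros; apply metric_smooth, g_metric.
  - intros; apply metric_sym; assumption.
  - intros; apply metric_det_pos; assumption.
  - apply gauss_curvature_smooth.
  - intros; apply K_neq.
Qed.

Lemma constant_power_metric beta l :
  constant_curvature_metric (power_metric beta) l <->
  forall i x y, dom i x y ->
    local_gauss_curvature (power_metric beta i) x y = l.
Proof.
  split.
  - intros [_ H] i x y Hi; symmetry; exact (H i x y Hi).
  - intros H; split; [apply power_metric_riemannian|].
    intros i x y Hi; symmetry; apply H, Hi.
Qed.

(** The curvature of the rescaled metric is a nonzero multiple of the left-hand
    side of the Ricci equation. *)
Lemma flat_power_metric a : a <> 0 ->
  generalized_ricci a 0 c g <-> flat_metric (power_metric (2 / a)).
Proof.
  intros a0; unfold flat_metric; rewrite generalized_ricciE, constant_power_metric.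
  assert (E : forall i x y, dom i x y ->
    let k := fun u v => K (par i u v) in
    local_gauss_curvature (power_metric (2 / a) i) x y =
    ((c - k x y) * laplacian (g i) k x y + norm_sq (g i) (grad (g i) k) x y
     + (a * k x y + 0) * (k x y - c) ^ 2)
    * / (a * (k x y - c) ^ 2 * Rpower (Rabs (k x y - c)) (2 / a))).
  { intros i x y Hi k; rewrite power_metric_curvature by exact Hi; fold k.
    pose proof (K_neq (par i x y)) as Hk.
    change (K (par i x y)) with (k x y) in *.
    assert (Rpower (Rabs (k x y - c)) (2 / a) <> 0) by apply Rgt_not_eq, exp_pos.
    field; auto. }
  split; intros H i x y Hi; specialize (H i x y Hi); specialize (E i x y Hi);
    cbv zeta in *.
  - rewrite E, H; ring.
  - rewrite E in H; apply Rmult_integral in H; destruct H as [H|H]; [exact H|].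
    exfalso; revert H; apply Rinv_neq_0_compat.
    apply Rmult_integral_contrapositive_currified.
    + apply Rmult_integral_contrapositive_currified; [exact a0|].
      apply pow_nonzero, K_neq.
    + apply Rgt_not_eq, exp_pos.
Qed.

(** The same proportionality, for the difference between the curvature and its
    prescribed value; the sign at [p0] is moved to the current point. *)
Lemma constant_linear_metric a p0 :
  generalized_ricci a ((2 - a) * c) c g <->
  constant_curvature_metric (power_metric 1) ((1 - a / 2) * sign (K p0 - c)).
Proof.
  rewrite generalized_ricciE, constant_power_metric.
  assert (E : forall i x y, dom i x y ->
    let k := fun u v => K (par i u v) in
    local_gauss_curvature (power_metric 1 i) x y - (1 - a / 2) * sign (K p0 - c) =
    ((c - k x y) * laplacian (g i) k x y + norm_sq (g i) (grad (g i) k) x y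
     + (a * k x y + (2 - a) * c) * (k x y - c) ^ 2)
    * / (2 * (k x y - c) ^ 2 * Rabs (k x y - c))).
  { intros i x y Hi k; rewrite power_metric_curvature by exact Hi; fold k.
    pose proof (K_neq (par i x y)) as Hk.
    rewrite (constant_sign (fun p => K p - c) p0 (par i x y)); [| |exact K_neq].
    2:{ intros j u v Hj; apply continuity_2d_pt_minus; [|apply continuity_2d_pt_const].
        apply (smooth_on_continuous (dom j)); [apply gauss_curvature_smooth|exact Hj]. }
    change (K (par i x y)) with (k x y) in *.
    pose proof (Rabs_pos_lt _ Hk) as Ha.
    rewrite Rpower_1 by exact Ha.
    destruct (Rtotal_order (k x y - c) 0) as [H|[H|H]]; [|contradiction|].
    - rewrite (sign_eq_m1 _ H), (Rabs_left _ H); field; lra.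
    - rewrite (sign_eq_1 _ H), (Rabs_right _ (Rgt_ge _ _ H)); field; lra. }
  split; intros H i x y Hi; specialize (H i x y Hi); specialize (E i x y Hi);
    cbv zeta in *.
  - apply Rminus_diag_uniq; rewrite E, H; ring.
  - rewrite H, Rminus_diag in E; symmetry in E.
    apply Rmult_integral in E; destruct E as [E|E]; [exact E|].
    exfalso; revert E; apply Rinv_neq_0_compat.
    apply Rmult_integral_contrapositive_currified.
    + apply Rmult_integral_contrapositive_currified; [lra|].
      apply pow_nonzero, K_neq.
    + apply Rabs_no_R0, K_neq.
Qed.

End PowerConformal.

(* In (2), the sign of K - c is read off at an arbitrary point p0. *)
Theorem corollary2p9 :
  forall (a c : R) (S : surface) (g : tensor S) (K : S -> R),
    riemannian_metric g ->
    is_gauss_curvature g K ->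
    (forall p : S, K p - c <> 0) ->
    (a <> 0 ->
       (generalized_ricci a 0 c g <->
        flat_metric (conformal (fun p => Rpower (Rabs (K p - c)) (2 / a)) g)))
    /\
    (forall b : R, b = (2 - a) * c ->
       forall p0 : S,
         (generalized_ricci a b c g <->
          constant_curvature_metric (conformal (fun p => Rabs (K p - c)) g)
            ((1 - a / 2) * sign (K p0 - c)))).
Proof.
  intros a c S g K Hg HK K_neq; split.
  - intros a0; exact (flat_power_metric S g K c Hg HK K_neq a a0).
  - intros b -> p0.
    replace (fun p => Rabs (K p - c)) with (fun p => Rpower (Rabs (K p - c)) 1).
    + exact (constant_linear_metric S g K c Hg HK K_neq a p0).
    + apply functional_extensionality; intros p.
      apply Rpower_1, Rabs_pos_lt, K_neq.
Qed.
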